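(* For each $N\ge 1$ let $U=U^{(N)}$ be a random $N\times N$ unitary matrix and $v=v^{(N)}$ a unit vector in $\mathbb{C}^N$, and for $t\in(-1,1)$ let $G(t)=U\,(I_N-(1-t)vv^* )$. Assume that the regularity assumption on $\mathscr{W}_2$ and the regularity assumption on $\omega_1^{(N)}$ (both stated in the context) hold. Let $z_t:=\frac{\sqrt N}{\omega_1^{(N)}}\frac{t}{1-t}$. Then for any $\alpha>\epsilon>0$, the following holds with high probability: (i) For $|t|<N^{-\frac12-\alpha}$, exactly one eigenvalue of $G(t)$ is in $D\left(z_t,|z_t|^2N^{\epsilon}\right)$, while all other eigenvalues are in $\mathbb{D}\setminus D\left(0,N^{-\epsilon}\right)$. (ii) For $|t|>N^{-\frac12+\alpha}$, all eigenvalues of $G(t)$ are in $\mathbb{D}\setminus D\left(0,1-|z_t|^{-1}N^{\epsilon}\right)$.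
   Context: Notation: $\mathbb{D}$ is the open unit disk in $\mathbb{C}$, and $D(z_0,r)$ is the open disk of center $z_0$ and radius $r$. A sequence of events $\Omega^{(N)}$ holds with high probability if $\mathbb{P}(\Omega^{(N)})\to1$ as $N\to\infty$; it holds with overwhelming probability if for every $A>0$, $1-\mathbb{P}(\Omega^{(N)})<N^{-A}$ for all large enough $N$. Stochastic domination: for families $X^{(N)}(z),Y^{(N)}(z)$ of complex random variables indexed by $N$ and $z\in\mathbb{D}$, and sets $\mathscr{S}^{(N)}\subset\mathbb{D}$, ''$X\prec Y$ uniformly for $z\in\mathscr{S}^{(N)}$'' means that for every $\epsilon>0$, with overwhelming probability, $|X^{(N)}(z)|\le N^\epsilon|Y^{(N)}(z)|$ for all $z\in\mathscr{S}^{(N)}$. Define $\omega_1^{(N)}:=\sqrt N\,v^*U^*v$ and, for $z\in\mathbb{D}$, $\mathscr{W}_2(z):=v^*(zU^* )^2(I_N-zU^* )^{-1}v$. The point $z_t$ is the unique solution of $1+\frac{\omega_1^{(N)}}{\sqrt N}z=\frac{1}{1-t}$. Regularity assumption on $\mathscr{W}_2$: for any $\delta>0$, $\mathscr{W}_2(z)\prec\frac{|z|^2}{\sqrt N(1-|z|)}$ uniformly for $z\in\mathbb{D}_\delta:=D(0,1-N^{-\delta})$. Regularity assumption on $\omega_1^{(N)}$: for any $\epsilon>0$, $N^{\epsilon}>|\omega_1^{(N)}|>N^{-\epsilon}$ holds with high probability.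
   Formalization: At t=0 the empty disk in (i) is replaced by its centre {0}; ''in the open disk'' is proved when w.h.p. no eigenvector of U is orthogonal to v (necessary, since such eigenvectors keep eigenvalues of modulus 1), and with the closed unit disk in general. *)

(* Defs.v *)
From mathcomp Require Import all_boot all_order all_algebra.
From mathcomp Require Import all_classical all_reals all_analysis.
From mathcomp Require Import spectral complex.

Set Implicit Arguments.
Unset Strict Implicit.
Unset Printing Implicit Defensive.

Import Order.TTheory GRing.Theory Num.Theory.
Import numFieldNormedType.Exports.
Local Open Scope classical_set_scope.
Local Open Scope complex_scope.
Local Open Scope sesquilinear_scope.
Local Open Scope ring_scope.

Section Probability.
Context (R : realType) (d : nat -> measure_display)
        (T : forall N, measurableType (d N)) (P : forall N, probability (T N) R).

(* The events below quantify over uncountably many t or z.  As they are not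
   assumed measurable, each notion asks for measurable events F N contained in
   E N; when the E N are measurable one may take F = E and the usual definition
   is recovered. *)
Definition with_high_probability (E : forall N, set (T N)) : Prop :=
  exists F : forall N, set (T N),
    [/\ forall N, measurable (F N), forall N, F N `<=` E N &
        P N (F N) @[N --> \oo] --> 1%E].

Definition with_overwhelming_probability (E : forall N, set (T N)) : Prop :=
  exists F : forall N, set (T N),
    [/\ forall N, measurable (F N), forall N, F N `<=` E N &
        forall A : R, 0 < A ->
          \forall N \near \oo, (1 - P N (F N) < (N%:R `^ (- A))%:E)%E].

Definition stochastically_dominated
    (X Y : forall N, R[i] -> T N -> R[i]) (S : nat -> set R[i]) : Prop :=
  forall eps : R, 0 < eps ->
    with_overwhelming_probability (fun N => [set w | forall z, S N z ->
      Normc.normc (X N z w) <= N%:R `^ eps * Normc.normc (Y N z w)]).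

End Probability.

Definition random_matrix (R : realType) d (T : measurableType d) (n : nat)
    (U : T -> 'M[R[i]]_n) : Prop :=
  forall i j, measurable_fun setT (fun w => complex.Re (U w i j)) /\
              measurable_fun setT (fun w => complex.Im (U w i j)).

Section Disks.
Context (R : realType).

Definition open_disk (c : R[i]) (r : R) : set R[i] :=
  [set z | Normc.normc (z - c) < r].

Definition unit_disk : set R[i] := open_disk 0 1.

Definition closed_unit_disk : set R[i] := [set z | Normc.normc z <= 1].

(* Equal to open_disk c r when r > 0, and to the single point c when r = 0. *)
Definition centered_disk (c : R[i]) (r : R) : set R[i] :=
  c |` open_disk c r.

End Disks.

Arguments unit_disk R : clear implicits.
Arguments closed_unit_disk R : clear implicits.

Section RankOnePerturbation.
Context (R : realType) (N : nat).
Implicit Types (U A : 'M[R[i]]_N) (v : 'cV[R[i]]_N) (t : R) (z : R[i]).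

Definition omega1 U v : R[i] :=
  (Num.sqrt N%:R)%:C * (v^t* *m U^t* *m v) 0 0.

Definition W2 U v z : R[i] :=
  (v^t* *m (z *: U^t*) ^+ 2 *m invmx (1%:M - z *: U^t*) *m v) 0 0.

Definition G U v t : 'M[R[i]]_N := U *m (1%:M - (1 - t)%:C *: (v *m v^t*)).

Definition z_t U v t : R[i] := (Num.sqrt N%:R)%:C / omega1 U v * (t / (1 - t))%:C.

(* with algebraic multiplicities *)
Definition eigenvalues A : seq R[i] :=
  sval (closed_field_poly_normal (char_poly A)).

Definition no_orthogonal_eigenvector U v : Prop :=
  forall (x : 'cV[R[i]]_N) (l : R[i]),
    x != 0 -> U *m x = l *: x -> v^t* *m x != 0.

(* At t = 0 one has z_t = 0 and the open disk of radius |z_t|^2 N^eps is empty,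
   although 0 is an eigenvalue of G(0); centered_disk then stands for {0}. *)
Definition one_outlier (D : set R[i]) (eps : R) U v t : Prop :=
  let zt := z_t U v t in
  let outlier := centered_disk zt (Normc.normc zt ^+ 2 * N%:R `^ eps) in
  count (fun l => `[< outlier l >]) (eigenvalues (G U v t)) = 1%N /\
  forall l, l \in eigenvalues (G U v t) -> ~ outlier l ->
    (D `\` open_disk 0 (N%:R `^ (- eps))) l.

Definition no_outlier (D : set R[i]) (eps : R) U v t : Prop :=
  forall l, l \in eigenvalues (G U v t) ->
    (D `\` open_disk 0 (1 - (Normc.normc (z_t U v t))^-1 * N%:R `^ eps)) l.

(* D is the unit disk, open or closed.  An eigenvector of U orthogonal to v is
   also an eigenvector of G(t), for the same eigenvalue of modulus 1; for
   |t| < 1, all other eigenvalues of G(t) are in the open disk. *)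
Definition eigenvalue_location (D : set R[i]) (alpha eps : R) U v : Prop :=
  forall t, -1 < t < 1 ->
    (`|t| < N%:R `^ (- 2^-1 - alpha) -> one_outlier D eps U v t) /\
    (N%:R `^ (- 2^-1 + alpha) < `|t| -> no_outlier D eps U v t).

End RankOnePerturbation.

(* Main.v *)
(** Writing K(z) = v^* (1 - z U^* )^-1 v, the matrix determinant lemma gives
    det(z - G(t)) = det(z - U) (1 - (1 - t) K(z)) for |z| < 1, so the eigenvalues
    of G(t) in the open disk are the solutions of K(z) - 1 = t / (1 - t).  Since
    K(z) - 1 = z omega_1 / sqrt N + W_2(z), this equation reads
    z = z_t - (sqrt N / omega_1) W_2(z).

    (i) By the bound on W_2, every solution of modulus less than N^-eps lies in
    the outlier disk.  To count them with multiplicities without Rouche's theorem,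
    multiply |p| over the m-th roots of r^m: for p = prod (X - l) this is
    prod |l^m - r^m|.  Passing from radius r to r / 4 divides it by about 4^m for
    each root inside, while 1 - (1 - t) K(z), being close to a multiple of z,
    contributes about 4^m in total; hence there is exactly one root inside.

    (ii) One has |K(z) - 1| (1 - |z|) <= 15 N^(e - 1/2) in the whole disk.  The
    assumption on W_2 gives this for |z| <= 1 - 1/N.  For other z, compare with the
    point z0 of modulus 1 - 1/N on the same ray, through
    K(z) - K(z0) = (z - z0) v^* R(z) U^* R(z0) v with R(z) = (1 - z U^* )^-1, the
    identity (1 - |z|^2) ||R(z) v||^2 = 2 Re K(z) - 1 and the AM-GM inequality. *)

Require Import Defs.
From mathcomp Require Import all_boot all_order all_algebra.
From mathcomp Require Import all_classical all_reals all_analysis.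
From mathcomp Require Import spectral complex.
From mathcomp Require Import ring lra.

Set Implicit Arguments.
Unset Strict Implicit.
Unset Printing Implicit Defensive.

Import Order.TTheory GRing.Theory Num.Theory.
Import numFieldNormedType.Exports.
Local Open Scope classical_set_scope.
Local Open Scope complex_scope.
Local Open Scope sesquilinear_scope.
Local Open Scope ring_scope.

(** * Modulus of complex numbers *)

Section ComplexModulus.
Context (R : realType).
Implicit Types (x y z : R[i]).

Lemma normc_ge0 z : 0 <= Normc.normc z.
Proof. by case: z => a b; rewrite /Normc.normc sqrtr_ge0. Qed.

Lemma normc_triangle x y : Normc.normc (x + y) <= Normc.normc x + Normc.normc y.
Proof. exact: le_normcD. Qed.

Lemma normc_opp z : Normc.normc (- z) = Normc.normc z.
Proof. exact: normcN. Qed.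

Lemma normc_dist_ge x y :
  Normc.normc x - Normc.normc y <= Normc.normc (x - y).
Proof. by rewrite lerBlDr -{1}(subrK y x) normc_triangle. Qed.

Lemma normc_exp z n : Normc.normc (z ^+ n) = Normc.normc z ^+ n.
Proof.
by elim: n => [|n IHn]; rewrite ?expr0 ?Normc.normc1 // !exprS Normc.normcM IHn.
Qed.

Lemma normc_prod (I : Type) (s : seq I) (F : I -> R[i]) :
  Normc.normc (\prod_(i <- s) F i) = \prod_(i <- s) Normc.normc (F i).
Proof.
elim: s => [|i s IHs]; first by rewrite !big_nil Normc.normc1.
by rewrite !big_cons Normc.normcM IHs.
Qed.

Lemma normc_real (a : R) : Normc.normc a%:C = `|a|.
Proof. by rewrite /Normc.normc /= expr0n addr0 sqrtr_sqr. Qed.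

Lemma normc_eq0 z : (Normc.normc z == 0) = (z == 0).
Proof.
apply/eqP/eqP => [|->]; [exact: Normc.eq0_normc | exact: Normc.normc0].
Qed.

Lemma normc_conj z : Normc.normc (z^*)%C = Normc.normc z.
Proof. by case: z => a b; rewrite /Normc.normc /= sqrrN. Qed.

Lemma mul_conj_normc z : (z^*)%C * z = (Normc.normc z ^+ 2)%:C.
Proof.
case: z => a b; rewrite /Normc.normc sqr_sqrtr ?addr_ge0 ?sqr_ge0 //.
by apply/eqP; rewrite eq_complex /=; apply/andP; split; apply/eqP; ring.
Qed.

Lemma Re_le_normc z : `|complex.Re z| <= Normc.normc z.
Proof.
case: z => a b /=; rewrite -sqrtr_sqr ler_sqrt ?addr_ge0 ?sqr_ge0 //.
by rewrite lerDl sqr_ge0.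
Qed.

Lemma Re_le_normc_sub1 z : complex.Re z <= 1 + Normc.normc (z - 1).
Proof.
have := le_trans (ler_norm _) (Re_le_normc (z - 1)).
by case: z => a b; rewrite -lerBlDl.
Qed.

End ComplexModulus.

(** * Hermitian geometry of column vectors *)

Section ColumnNorm.
Context (R : realType) (n : nat).
Implicit Types (x y v : 'cV[R[i]]_n) (A : 'M[R[i]]_n).

Definition sqnorm x : R := \sum_i Normc.normc (x i 0) ^+ 2.

Lemma sqnorm_ge0 x : 0 <= sqnorm x.
Proof. by apply: sumr_ge0 => i _; rewrite sqr_ge0. Qed.

Lemma sqnorm_eq0 x : sqnorm x = 0 -> x = 0.
Proof.
move=> /eqP; rewrite psumr_eq0 => [|i _]; last exact: sqr_ge0.
move=> /allP x0; apply/matrixP => i j; rewrite ord1 mxE.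
have := x0 i; rewrite mem_index_enum => /(_ isT) /=.
by rewrite sqrf_eq0 normc_eq0 => /eqP.
Qed.

Lemma innerE x y : (x^t* *m y) 0 0 = \sum_i (x i 0)^*%C * y i 0.
Proof. by rewrite mxE; apply: eq_bigr => i _; rewrite !mxE. Qed.

Lemma inner_conj x y : (x^t* *m y) 0 0 = (((y^t* *m x) 0 0)^*)%C.
Proof.
rewrite !innerE rmorph_sum; apply: eq_bigr => i _.
by rewrite rmorphM /= conjcK mulrC.
Qed.

Lemma inner_self x : (x^t* *m x) 0 0 = (sqnorm x)%:C.
Proof.
by rewrite innerE /sqnorm rmorph_sum; apply: eq_bigr => i _; exact: mul_conj_normc.
Qed.

Lemma innerZl (a : R[i]) x y :
  ((a *: x)^t* *m y) 0 0 = (a^*)%C * (x^t* *m y) 0 0.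
Proof.
rewrite !innerE mulr_sumr; apply: eq_bigr => i _.
by rewrite mxE rmorphM /= mulrA.
Qed.

Lemma sqnorm_isometry A x : A^t* *m A = 1%:M -> sqnorm (A *m x) = sqnorm x.
Proof.
move=> AA; apply: complexI.
by rewrite -!inner_self trmx_mul map_mxM mulmxA -(mulmxA _ _ A) AA mulmx1.
Qed.

Lemma sqnormZ (a : R[i]) x : sqnorm (a *: x) = Normc.normc a ^+ 2 * sqnorm x.
Proof.
by rewrite /sqnorm mulr_sumr; apply: eq_bigr => i _; rewrite mxE Normc.normcM exprMn.
Qed.

Lemma sqnormB x y :
  sqnorm (x - y) = sqnorm x - 2 * complex.Re ((y^t* *m x) 0 0) + sqnorm y.
Proof.
have -> : complex.Re ((y^t* *m x) 0 0) = \sum_i complex.Re ((y i 0)^*%C * x i 0).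
  by rewrite innerE raddf_sum.
rewrite /sqnorm mulr_sumr -sumrB -big_split /=; apply: eq_bigr => i _.
rewrite !mxE; case: (x i 0) (y i 0) => a b [c d].
by rewrite /Normc.normc !sqr_sqrtr ?addr_ge0 ?sqr_ge0 //=; ring.
Qed.

(** Termwise the gap is the square [a^-1 * (a * p - q) ^+ 2 / 2]. The free weight [a] stands in for
    Cauchy-Schwarz and is tuned in [radial_growth_arith]. *)
Lemma inner_le_AMGM (a : R) x y : 0 < a ->
  Normc.normc ((y^t* *m x) 0 0) <= (a * sqnorm y + a^-1 * sqnorm x) / 2.
Proof.
move=> a0; rewrite innerE; apply: (@le_trans _ _
  (\sum_i Normc.normc (y i 0) * Normc.normc (x i 0))).
  elim/big_ind2: _ => [|u1 b1 u2 b2 h1 h2|i _]; first by rewrite Normc.normc0.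
    exact: (le_trans (normc_triangle _ _)) (lerD h1 h2).
  by rewrite Normc.normcM normc_conj.
rewrite /sqnorm !mulr_sumr -big_split /= mulr_suml; apply: ler_sum => i _.
set p := Normc.normc (y i 0); set q := Normc.normc (x i 0).
have -> : (a * p ^+ 2 + a^-1 * q ^+ 2) / 2 = p * q + a^-1 * (a * p - q) ^+ 2 / 2.
  by field; rewrite gt_eqF.
by rewrite lerDl; apply: mulr_ge0 => //; rewrite mulr_ge0 ?sqr_ge0 ?invr_ge0 ?ltW.
Qed.

End ColumnNorm.

(** * Resolvents of unitary matrices and the function K *)

Section Resolvent.
Context (R : realType) (n : nat).
Implicit Types (x v : 'cV[R[i]]_n) (A U : 'M[R[i]]_n) (z : R[i]) (t : R).

Lemma unitmx_of_ker A : (forall x, A *m x = 0 -> x = 0) -> A \in unitmx.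
Proof.
move=> kerA; rewrite -unitmx_tr -row_free_unit; apply: inj_row_free => u uA.
by apply: trmx_inj; rewrite trmx0; apply: kerA; rewrite -(trmxK A) -trmx_mul uA trmx0.
Qed.

Lemma unitary_adjmul U : U \is unitarymx -> U^t* *m U = 1%:M.
Proof. by move=> uU; rewrite -(mul1mx (U^t*)) mulmxKtV. Qed.

Lemma adjmxK A : (A^t*)^t* = A.
Proof. by apply/matrixP => i j; rewrite !mxE conjCK. Qed.

(** Lets the resolvent lemmas, stated for an isometry [A], apply to the adjoint of [U] as well. *)
Lemma unitary_muladj U : U \is unitarymx -> (U^t*)^t* *m U^t* = 1%:M.
Proof. by rewrite adjmxK => /unitarymxP. Qed.

(** A kernel vector satisfies [x = z *: (A *m x)], so its squared norm is [|z|^2 < 1] times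
    itself. *)
Lemma resolvent_unit A z : A^t* *m A = 1%:M -> Normc.normc z < 1 ->
  1%:M - z *: A \in unitmx.
Proof.
move=> AA z1; apply: unitmx_of_ker => x; rewrite mulmxBl mul1mx -scalemxAl.
move/eqP; rewrite subr_eq0 => /eqP xE; apply: sqnorm_eq0.
have := congr1 (@sqnorm R n) xE; rewrite sqnormZ (sqnorm_isometry _ AA) => sE.
have := sqnorm_ge0 x; have := normc_ge0 z; have sx : Normc.normc z ^+ 2 < 1.
  by rewrite expr_lt1 ?normc_ge0.
nra.
Qed.

(** Take squared norms in [x - v = z *: (A *m x)], where [x] is the resolvent applied to [v]. *)
Lemma resolvent_sqnorm A v z : A^t* *m A = 1%:M -> Normc.normc z < 1 ->
  sqnorm v = 1 ->
  (1 - Normc.normc z ^+ 2) * sqnorm (invmx (1%:M - z *: A) *m v) =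
  2 * complex.Re ((v^t* *m invmx (1%:M - z *: A) *m v) 0 0) - 1.
Proof.
move=> AA z1 v1; rewrite -mulmxA; set x := invmx _ *m v.
have xv : x - v = z *: (A *m x).
  rewrite scalemxAl -[in LHS](mulKVmx (resolvent_unit AA z1) v) -/x.
  by rewrite mulmxBl mul1mx opprB addrCA subrr addr0.
have := congr1 (@sqnorm R n) xv.
by rewrite sqnormB sqnormZ (sqnorm_isometry _ AA) v1; lra.
Qed.

(** The K of the overview. For unitary [U] it is a Cauchy integral of the spectral measure of [U] at
    [v], and [2 Re K - 1] is its Poisson integral. *)
Definition poisson_form U v z : R[i] :=
  (v^t* *m invmx (1%:M - z *: U^t*) *m v) 0 0.

Lemma poisson_form_split U v z : U \is unitarymx -> sqnorm v = 1 ->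
  Normc.normc z < 1 ->
  poisson_form U v z = 1 + z * (v^t* *m U^t* *m v) 0 0 + W2 U v z.
Proof.
move=> uU v1 z1; rewrite /poisson_form /W2.
have uM := resolvent_unit (unitary_muladj uU) z1.
set B := z *: U^t* in uM *; set M := invmx _.
(* Substituting [M = 1 + B M] into itself splits off the first two terms of the Neumann series. *)
have ME : M = 1%:M + B + B *m B *m M.
  have BM : B *m M = M - 1%:M.
    by rewrite -(mulmxV uM) -/M mulmxBl mul1mx opprB addrCA subrr addr0.
  by rewrite -mulmxA BM mulmxBr BM mulmx1 -[M - _ - _]addrA -opprD addrCA subrr addr0.
have addE (X Y : 'M[R[i]]_1) : (X + Y) 0 0 = X 0 0 + Y 0 0 by rewrite mxE.
rewrite {1}ME !mulmxDr !mulmxDl mulmx1 !addE.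
have -> : (v^t* *m v) 0 0 = 1 by rewrite inner_self v1.
have -> : (v^t* *m B *m v) 0 0 = z * (v^t* *m U^t* *m v) 0 0.
  by rewrite -(scalemxAr z) -(scalemxAl z) mxE.
by rewrite expr2 !mulmxA.
Qed.

(** Here [rho], [eta] are the distances of z, z0 to the unit circle, [w], [w0] the moduli of K - 1,
    [k], [k0] the real parts of K, [Y], [X] squared norms of resolvent vectors, [p] the modulus of
    their inner product and [D] that of z - z0. With weight [rho / (2 * eta)] the [Y] term costs at
    most [rho / 4] plus half of [rho * w], and the left side absorbs that half. *)
Lemma radial_growth_arith (rho eta w w0 k k0 X Y p D : R) :
  0 < rho -> rho <= eta -> eta <= 1 -> 0 <= w0 -> 0 <= X -> 0 <= Y ->
  0 <= p -> k <= 1 + w -> k0 <= 1 + w0 ->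
  (1 - (1 - rho) ^+ 2) * Y = 2 * k - 1 ->
  (1 - (1 - eta) ^+ 2) * X = 2 * k0 - 1 ->
  p <= (rho / (2 * eta) * Y + (rho / (2 * eta))^-1 * X) / 2 ->
  D <= eta -> w - w0 <= D * p ->
  rho * w <= eta * (6 * w0 + 3).
Proof.
move=> rho0 rho_eta eta1 w00 X0 Y0 p0 kw k0w YE XE pXY Deta wD.
have eta0 := lt_le_trans rho0 rho_eta.
have rY : rho * Y <= 1 + 2 * w.
  have := mulr_ge0 (mulr_ge0 (ltW rho0) Y0) (_ : 0 <= 1 - rho); lra.
have eX : eta * X <= 1 + 2 * w0.
  have := mulr_ge0 (mulr_ge0 (ltW eta0) X0) (_ : 0 <= 1 - eta); lra.
have pE : eta * rho * p <= rho ^+ 2 * Y / 4 + eta ^+ 2 * X.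
  have := ler_wpM2l (ltW (mulr_gt0 eta0 rho0)) pXY.
  congr (_ <= _); field; lra.
have wE : rho * (w - w0) <= eta * rho * p.
  rewrite -mulrA mulrCA ler_pM2l //; apply: le_trans wD _.
  exact: ler_wpM2r.
have h1 := ler_wpM2l (ltW rho0) rY; have h2 := ler_wpM2l (ltW eta0) eX.
have h3 := ler_wpM2r w00 rho_eta.
nra.
Qed.

Lemma radial_growth U v z z0 : U \is unitarymx -> sqnorm v = 1 ->
  Normc.normc z < 1 -> Normc.normc z0 <= Normc.normc z ->
  Normc.normc (z - z0) <= 1 - Normc.normc z0 ->
  (1 - Normc.normc z) * Normc.normc (poisson_form U v z - 1) <=
  (1 - Normc.normc z0) * (6 * Normc.normc (poisson_form U v z0 - 1) + 3).
Proof.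
move=> uU v1 z1 z0z zz0; have z01 := le_lt_trans z0z z1.
have uM := resolvent_unit (unitary_muladj uU) z1.
have uM0 := resolvent_unit (unitary_muladj uU) z01.
pose y := (invmx (1%:M - z *: U^t*))^t* *m v.
pose x := invmx (1%:M - z0 *: U^t*) *m v.
have diffE : poisson_form U v z - poisson_form U v z0 =
    (z - z0) * (y^t* *m (U^t* *m x)) 0 0.
  have yE : y^t* = v^t* *m invmx (1%:M - z *: U^t*).
    by rewrite /y trmx_mul map_mxM adjmxK.
  have addE (X Y : 'M[R[i]]_1) : X 0 0 - Y 0 0 = (X - Y) 0 0 by rewrite !mxE.
  rewrite yE /x /poisson_form addE -mulmxBl -mulmxBr.
  have -> : invmx (1%:M - z *: U^t*) - invmx (1%:M - z0 *: U^t*) =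
      (z - z0) *: (invmx (1%:M - z *: U^t*) *m U^t* *m invmx (1%:M - z0 *: U^t*)).
    (* Resolvent identity: between the two inverses remains the difference of the inverted matrices,
       [z - z0] times the adjoint of [U]. *)
    rewrite -[X in X - _](mulmxK uM0) -[X in _ - X](mulKmx uM) -!mulmxA.
    rewrite -mulmxBr -mulmxBl opprB [X in _ *m (X *m _)]addrC addrA subrK.
    by rewrite -scalerBl -scalemxAl -scalemxAr.
  by rewrite -scalemxAr -scalemxAl mxE !mulmxA.
have Ynorm : (1 - Normc.normc z ^+ 2) * sqnorm y =
    2 * complex.Re (poisson_form U v z) - 1.
  (* The adjoint of the resolvent of [U^t*] at z is the resolvent of [U] at the conjugate of z. *)
  have yE : y = invmx (1%:M - (z^*)%C *: U) *m v.
    rewrite /y trmx_inv map_invmx; congr (invmx _ *m _).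
    by rewrite linearB linearZ /= trmx1 map_mxB map_mx1 map_mxZ adjmxK.
  have zc1 : Normc.normc (z^*)%C < 1 by rewrite normc_conj.
  have := resolvent_sqnorm (unitary_adjmul uU) zc1 v1.
  rewrite -mulmxA -yE normc_conj => ->; congr (2 * _ - 1).
  rewrite inner_conj {1}/y trmx_mul map_mxM adjmxK -/(poisson_form U v z).
  by case: (poisson_form U v z).
have Xnorm : (1 - Normc.normc z0 ^+ 2) * sqnorm (U^t* *m x) =
    2 * complex.Re (poisson_form U v z0) - 1.
  rewrite (sqnorm_isometry _ (unitary_muladj uU)).
  exact: (resolvent_sqnorm (unitary_muladj uU) z01 v1).
have dist : Normc.normc (poisson_form U v z - 1) -
    Normc.normc (poisson_form U v z0 - 1) <=
    Normc.normc (z - z0) * Normc.normc ((y^t* *m (U^t* *m x)) 0 0).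
  rewrite -Normc.normcM -diffE; apply: le_trans (normc_dist_ge _ _) _.
  by rewrite opprB addrA subrK.
have a0 : 0 < (1 - Normc.normc z) / (2 * (1 - Normc.normc z0)).
  by rewrite divr_gt0 ?mulr_gt0 ?subr_gt0.
apply: (@radial_growth_arith _ _ _ _ (complex.Re (poisson_form U v z))
  (complex.Re (poisson_form U v z0)) (sqnorm (U^t* *m x)) (sqnorm y)
  (Normc.normc ((y^t* *m (U^t* *m x)) 0 0)) (Normc.normc (z - z0)));
  rewrite ?subr_gt0 ?lerD2l ?lerN2 ?gerBl ?normc_ge0 ?sqnorm_ge0 ?subKr //.
- exact: Re_le_normc_sub1.
- exact: Re_le_normc_sub1.
- exact: inner_le_AMGM.
Qed.

End Resolvent.

(** * Characteristic polynomial and eigenvalues of the perturbed matrix *)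

Section Eigenvalues.
Context (R : realType) (n : nat).
Implicit Types (x v : 'cV[R[i]]_n) (A U : 'M[R[i]]_n) (z l : R[i]) (t : R).

(** Both sides are the determinant of one block matrix, factored in two ways as a block lower times
    a block upper triangular matrix or the reverse. *)
Lemma det_rank_one (F : comPzRingType) m (u : 'cV[F]_m) (w : 'rV[F]_m) :
  \det (1%:M + u *m w) = 1 + (w *m u) 0 0.
Proof.
have E1 : block_mx (1%:M : 'M[F]_1) (- w) u 1%:M =
    block_mx 1%:M 0 u 1%:M *m block_mx 1%:M (- w) 0 (1%:M + u *m w).
  by rewrite mulmx_block !(mul1mx, mulmx1, mul0mx, mulmx0, addr0)
     mulmxN addrCA addNr addr0.
have E2 : block_mx (1%:M : 'M[F]_1) (- w) u 1%:M =
    block_mx (1%:M + w *m u) (- w) 0 1%:M *m block_mx 1%:M 0 u 1%:M.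
  by rewrite mulmx_block !(mul1mx, mulmx1, mul0mx, mulmx0, addr0, add0r)
     mulNmx addrK.
have := congr1 determinant E2; rewrite E1 !det_mulmx !det_lblock !det_ublock.
by rewrite !det1 !mul1r !mulr1 => ->; rewrite det_mx11 !mxE eqxx.
Qed.

Lemma horner_char_poly A z : (char_poly A).[z] = \det (z%:M - A).
Proof.
rewrite /char_poly -[LHS]/(horner_eval z _) -det_map_mx; congr (\det _).
apply/matrixP => i j.
by rewrite !mxE raddfB raddfMn /= /horner_eval hornerX hornerC.
Qed.

Lemma char_poly_eigenvalues A :
  char_poly A = \prod_(l <- eigenvalues A) ('X - l%:P).
Proof.
rewrite /eigenvalues; case: closed_field_poly_normal => s /= {1}->.
by rewrite (monicP (char_poly_monic A)) scale1r.
Qed.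

Lemma eigenvaluesP A l : l \in eigenvalues A ->
  exists2 x : 'cV[R[i]]_n, x != 0 & A *m x = l *: x.
Proof.
move=> lA; have : root (char_poly A) l.
  by rewrite char_poly_eigenvalues root_prod_XsubC.
rewrite rootE horner_char_poly => detA; apply: contrapT => noeig.
have /unitmx_of_ker : forall x, (l%:M - A) *m x = 0 -> x = 0.
  move=> x; rewrite mulmxBl mul_scalar_mx => /eqP; rewrite subr_eq0 => /eqP xE.
  by apply: contrapT => /eqP x0; apply: noeig; exists x.
by rewrite unitmxE (eqP detA) unitr0.
Qed.

Lemma eigenvalues_unitary U l : U \is unitarymx -> l \in eigenvalues U ->
  Normc.normc l = 1.
Proof.
move=> uU /eigenvaluesP[x x0 xE]; apply/eqP.
have sx0 : sqnorm x != 0 by apply: contra_neq x0; exact: sqnorm_eq0.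
have := congr1 (@sqnorm R n) xE; rewrite (sqnorm_isometry _ (unitary_adjmul uU)).
rewrite sqnormZ -{1}[sqnorm x]mul1r => /(mulIf sx0) /esym /eqP.
by rewrite sqrf_eq1 => /orP[//|/eqP lN]; have := normc_ge0 l; rewrite lN ler0N1.
Qed.

(** The rank-one factor multiplies the component along [v] by t, so it lowers the squared norm by
    [(1 - t^2) |v^* x|^2], and [U] preserves norms. Modulus 1 thus forces [v^* x = 0], and [x] is
    then an eigenvector of [U] orthogonal to [v]. *)
Lemma eigenvalues_G U v t l : U \is unitarymx -> sqnorm v = 1 -> -1 < t < 1 ->
  l \in eigenvalues (G U v t) ->
  Normc.normc l <= 1 /\ (no_orthogonal_eigenvector U v -> Normc.normc l < 1).
Proof.
move=> uU v1 /andP[tN1 t1] /eigenvaluesP[x x0 xE].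
have sx0 : 0 < sqnorm x.
  rewrite lt_def sqnorm_ge0 andbT.
  by apply: contra_neq x0; exact: sqnorm_eq0.
pose a := (v^t* *m x) 0 0; pose y := x - ((1 - t)%:C * a) *: v.
have yE : U *m y = l *: x.
  rewrite -xE /G -mulmxA; congr (_ *m _); rewrite mulmxBl mul1mx /y; congr (_ - _).
  rewrite -scalemxAl -mulmxA [v^t* *m x]mx11_scalar -/a mul_mx_scalar.
  by rewrite scalerA.
have sy : sqnorm y = sqnorm x - (1 - t ^+ 2) * Normc.normc a ^+ 2.
  rewrite /y sqnormB sqnormZ v1 Normc.normcM normc_real.
  have -> : complex.Re (((((1 - t)%:C * a) *: v)^t* *m x) 0 0) =
      (1 - t) * Normc.normc a ^+ 2.
    rewrite innerZl -/a; case: (a) => p q.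
    by rewrite /Normc.normc sqr_sqrtr ?addr_ge0 ?sqr_ge0 //=; ring.
  rewrite exprMn -normrX ger0_norm ?sqr_ge0 //; ring.
have ly : Normc.normc l ^+ 2 * sqnorm x = sqnorm y.
  by rewrite -sqnormZ -yE (sqnorm_isometry _ (unitary_adjmul uU)).
have t2 : 0 < 1 - t ^+ 2 by nra.
have l1 : Normc.normc l <= 1.
  rewrite -(expr_le1 (n := 2)) ?normc_ge0 // -(ler_pM2r sx0) ly sy mul1r gerBl.
  by rewrite mulr_ge0 ?sqr_ge0 // ltW.
split=> // noorth; rewrite lt_neqAle l1 andbT; apply/eqP => lE.
have a0 : a = 0.
  apply/eqP; rewrite -normc_eq0 -sqrf_eq0.
  move: ly; rewrite lE expr1n mul1r sy => /eqP.
  by rewrite -subr_eq0 opprB addrC subrK mulf_eq0 gt_eqF.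
have Ux : U *m x = l *: x by rewrite -yE /y a0 mulr0 scale0r subr0.
have /eqP := noorth x l x0 Ux; apply.
by rewrite [v^t* *m x]mx11_scalar -/a a0 raddf0.
Qed.

Lemma char_poly_G U v t z : U \is unitarymx -> Normc.normc z < 1 ->
  (char_poly (G U v t)).[z] =
  (char_poly U).[z] * (1 - (1 - t)%:C * poisson_form U v z).
Proof.
move=> uU z1; have uM := resolvent_unit (unitary_muladj uU) z1.
rewrite !horner_char_poly /poisson_form.
set M := invmx _; set c := (1 - t)%:C.
(* As [z%:M - U] is [- U] times the matrix inverted by [M], one has [(z%:M - U) *m M = - U]; so
   [z%:M - U] factors out and leaves a rank-one perturbation of the identity. *)
have -> : z%:M - G U v t = (z%:M - U) *m (1%:M + ((- c) *: (M *m v)) *m v^t*).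
  have zU : z%:M - U = - U *m (1%:M - z *: U^t*).
    rewrite mulmxBr mulmx1 -scalemxAr mulNmx (unitarymxP uU) scalerN opprK addrC.
    by rewrite scalemx1.
  have zUM : (z%:M - U) *m M = - U by rewrite zU mulmxK.
  rewrite mulmxDr mulmx1 -scalemxAl -scalemxAr !mulmxA zUM /G mulmxBr mulmx1.
  by rewrite -scalemxAr !mulNmx scaleNr scalerN opprK mulmxA opprB addrA addrAC.
by rewrite det_mulmx det_rank_one -scalemxAr mxE mulmxA mulNr.
Qed.

End Eigenvalues.

(** * Counting roots through products over circles *)

Section RootCount.
Context (R : realType).
Implicit Types (y z l : R[i]) (ps qs s : seq R[i]) (r c : R) (m : nat).

(** The points are the roots of [X^m - r^m], listed with multiplicity; no trigonometric form is
    needed. *)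
Lemma circle_points m r : (0 < m)%N -> 0 <= r ->
  exists s, [/\ size s = m, forall y, y \in s -> Normc.normc y = r &
    forall z, \prod_(y <- s) (z - y) = z ^+ m - (r ^+ m)%:C].
Proof.
move=> m0 r0; pose p : {poly R[i]} := 'X^m - ((r ^+ m)%:C)%:P.
have [s pE] := closed_field_poly_normal p.
have p1 : lead_coef p = 1 by apply/monicP; exact: monicXnsubC.
rewrite p1 scale1r in pE.
have pz z : \prod_(y <- s) (z - y) = z ^+ m - (r ^+ m)%:C.
  have <- : p.[z] = z ^+ m - (r ^+ m)%:C.
    by rewrite /p hornerD hornerN hornerXn hornerC.
  by rewrite pE horner_prod; apply: eq_bigr => y _; rewrite hornerXsubC.
exists s; split => //.
  have := size_prod_XsubC s id; rewrite /= -pE /p size_XnsubC //.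
  by case.
move=> y ys; apply/eqP; rewrite -(eqrXn2 m0) ?normc_ge0 //; apply/eqP.
have : \prod_(x <- s) (y - x) = 0 by rewrite (big_rem y) //= subrr mul0r.
move=> /eqP; rewrite pz subr_eq0 => /eqP/(congr1 (@Normc.normc R)).
by rewrite normc_exp normc_real ger0_norm ?exprn_ge0.
Qed.

(* A discrete form of Jensen's formula. *)
Lemma prod_horner_circle s m r ps :
  (forall z, \prod_(y <- s) (z - y) = z ^+ m - (r ^+ m)%:C) ->
  \prod_(y <- s) Normc.normc (\prod_(l <- ps) ('X - l%:P)).[y] =
  \prod_(l <- ps) Normc.normc (l ^+ m - (r ^+ m)%:C).
Proof.
move=> sE; under eq_bigr do rewrite horner_prod normc_prod.
rewrite exchange_big /=; apply: eq_bigr => l _; rewrite -sE normc_prod.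
by apply: eq_bigr => y _; rewrite hornerXsubC -normc_opp opprB.
Qed.

(** As [m > 0], the m-th power of [l] has at most half the modulus of [r ^+ m], which fixes the
    difference up to a factor in [1/2, 3/2]. [dist_expn_outer] is the mirror case. *)
Lemma dist_expn_inner m r l : (0 < m)%N -> 0 <= r ->
  2 * Normc.normc l <= r ->
  r ^+ m <= 2 * Normc.normc (l ^+ m - (r ^+ m)%:C) <= 3 * r ^+ m.
Proof.
move=> m0 r0 lr; have lrm : 2 * Normc.normc l ^+ m <= r ^+ m.
  have := lerXn2r m (mulr_ge0 (ler0n R 2) (normc_ge0 l)) r0 lr.
  rewrite exprMn => h; apply: le_trans h.
  rewrite ler_wpM2r ?exprn_ge0 ?normc_ge0 // -{1}(expr1 2) ler_eXn2l //.
  by rewrite ltr1n.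
have := normc_dist_ge ((r ^+ m)%:C) (l ^+ m).
have := normc_triangle (l ^+ m) (- (r ^+ m)%:C).
rewrite normc_opp -(normc_opp (_ - l ^+ m)) opprB normc_exp normc_real.
by rewrite ger0_norm ?exprn_ge0 // => h1 h2; apply/andP; split; lra.
Qed.

Lemma dist_expn_outer m r l : (0 < m)%N -> 0 <= r ->
  2 * r <= Normc.normc l ->
  Normc.normc l ^+ m <= 2 * Normc.normc (l ^+ m - (r ^+ m)%:C)
    <= 3 * Normc.normc l ^+ m.
Proof.
move=> m0 r0 lr; have lrm : 2 * r ^+ m <= Normc.normc l ^+ m.
  have := lerXn2r m (mulr_ge0 (ler0n R 2) r0) (normc_ge0 l) lr.
  rewrite exprMn => h; apply: le_trans h.
  rewrite ler_wpM2r ?exprn_ge0 // -{1}(expr1 2) ler_eXn2l //.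
  by rewrite ltr1n.
have := normc_dist_ge (l ^+ m) ((r ^+ m)%:C).
have := normc_triangle (l ^+ m) (- (r ^+ m)%:C).
rewrite normc_opp normc_exp normc_real.
by rewrite ger0_norm ?exprn_ge0 // => h1 h2; apply/andP; split; lra.
Qed.

(** The gap hypothesis puts each root well inside both circles, of radii [r] and [r / 4], or well
    outside both. The ratio of its two factors is then [4 ^+ m], respectively 1, up to a factor
    3. *)
Lemma prod_dist_ratio m r ps : (0 < m)%N -> 0 < r ->
  (forall l, l \in ps -> 8 * Normc.normc l <= r \/ 2 * r <= Normc.normc l) ->
  let k := count (fun l => 8 * Normc.normc l <= r) ps in
  let P := fun rho : R => \prod_(l <- ps) Normc.normc (l ^+ m - (rho ^+ m)%:C) in
  [/\ 0 < P (r / 4), P r <= 3 ^+ size ps * (4 ^+ (m * k) * P (r / 4)) &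
      4 ^+ (m * k) * P (r / 4) <= 3 ^+ size ps * P r].
Proof.
move=> m0 r0; have r40 : 0 < r / 4 by rewrite divr_gt0.
have rE : r ^+ m = 4 ^+ m * (r / 4) ^+ m.
  by rewrite -exprMn mulrCA divff ?mulr1 // pnatr_eq0.
elim: ps => [|l ps IHps] psP /=.
  by rewrite !big_nil muln0 !expr0 !mul1r; split.
have /IHps : forall l0, l0 \in ps -> 8 * Normc.normc l0 <= r \/ 2 * r <= Normc.normc l0.
  by move=> l0 l0ps; apply: psP; rewrite in_cons l0ps orbT.
rewrite /= !big_cons; set k := count _ ps; set P := \prod_(_ <- _) _.
set Q := \prod_(_ <- _) _ => -[P0 QP PQ].
set d := Normc.normc (l ^+ m - _); set e := Normc.normc (l ^+ m - _).
pose K : R := if 8 * Normc.normc l <= r then 4 ^+ m else 1.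
have [d0 dK Kd] : [/\ 0 < d, e <= 3 * (K * d) & K * d <= 3 * e].
  have rm0 : 0 < (r / 4) ^+ m by rewrite exprn_gt0.
  have rm0' : 0 < r ^+ m by rewrite exprn_gt0.
  rewrite /K; case: ifPn => [lr|]; last first.
    have [-> // | lr _] := psP l (mem_head _ _).
    have l0 : 0 < Normc.normc l by apply: lt_le_trans lr; rewrite mulr_gt0.
    have lm0 : 0 < Normc.normc l ^+ m by rewrite exprn_gt0.
    have lr4 : 2 * (r / 4) <= Normc.normc l by lra.
    have /andP[] := dist_expn_outer m0 (ltW r0) lr.
    have /andP[] := dist_expn_outer m0 (ltW r40) lr4.
    by rewrite -/d -/e => *; split; lra.
  have nl := normc_ge0 l.
  have lr1 : 2 * Normc.normc l <= r by lra.
  have lr4 : 2 * Normc.normc l <= r / 4 by lra.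
  have /andP[] := dist_expn_inner m0 (ltW r0) lr1.
  have /andP[] := dist_expn_inner m0 (ltW r40) lr4.
  rewrite -/d -/e rE => h1 h2 h3 h4; have k0 : 0 < 4 ^+ m :> R by rewrite exprn_gt0.
  have h5 := ler_wpM2l (ltW k0) h1; have h6 := ler_wpM2l (ltW k0) h2.
  by split; lra.
have KE : 4 ^+ (m * ((8 * Normc.normc l <= r)%R + k)) = K * 4 ^+ (m * k) :> R.
  by rewrite mulnDr exprD /K; case: ifP; rewrite ?muln1 ?muln0.
have K0 : 0 < K by rewrite /K; case: ifP; rewrite ?exprn_gt0.
have e0 : 0 < e by have := mulr_gt0 K0 d0; lra.
have Q0 : 0 < Q.
  have mk0 : 0 < 4 ^+ (m * k) :> R by rewrite exprn_gt0.
  have sz0 : 0 < 3 ^+ size ps :> R by rewrite exprn_gt0.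
  by rewrite -(pmulr_rgt0 _ sz0) (lt_le_trans (mulr_gt0 mk0 P0)).
split; first exact: mulr_gt0.
  rewrite KE exprS; have := ler_pM (ltW e0) (ltW Q0) dK QP.
  by congr (_ <= _); ring.
rewrite KE exprS.
have := ler_pM (mulr_ge0 (ltW K0) (ltW d0))
  (mulr_ge0 (exprn_ge0 (m * k) (ler0n R 4)) (ltW P0)) Kd PQ.
by congr (_ <= _); ring.
Qed.

Lemma prod_ge_exp (I : eqType) (s : seq I) (F : I -> R) c : 0 <= c ->
  (forall i, i \in s -> c <= F i) -> c ^+ size s <= \prod_(i <- s) F i.
Proof.
move=> c0; elim: s => [|y s IHs] Fc; first by rewrite big_nil.
rewrite big_cons exprS ler_pM ?exprn_ge0 ?Fc ?mem_head //.
by apply: IHs => z zs; rewrite Fc // in_cons zs orbT.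
Qed.

Lemma prod_le_exp (I : eqType) (s : seq I) (F : I -> R) c :
  (forall i, i \in s -> 0 <= F i <= c) -> \prod_(i <- s) F i <= c ^+ size s.
Proof.
elim: s => [|y s IHs] Fc; first by rewrite big_nil.
have /andP[Fy0 Fyc] := Fc y (mem_head _ _).
have Fs (z : I) : z \in s -> 0 <= F z <= c by move=> zs; rewrite Fc // in_cons zs orbT.
rewrite big_cons exprS ler_pM ?IHs //.
by rewrite big_seq prodr_ge0 // => z /Fs/andP[].
Qed.

(** From radius [r] to [r / 4], the product over [ps] is divided by about [4 ^+ (m * k)], the one
    over [qs] is roughly kept, and the one of [g] is divided by a number between [2 ^+ m] and
    [8 ^+ m]. With the errors below [2 ^+ m], only [k = 1] fits. *)
Lemma count_small_roots ps qs r c (g : R[i] -> R[i]) : 0 < r -> 0 < c ->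
  (forall l, l \in ps -> 8 * Normc.normc l <= r \/ 2 * r <= Normc.normc l) ->
  (forall l, l \in qs -> 2 * r <= Normc.normc l) ->
  (forall z, Normc.normc z = r \/ Normc.normc z = r / 4 ->
     (\prod_(l <- ps) ('X - l%:P)).[z] = (\prod_(l <- qs) ('X - l%:P)).[z] * g z /\
     2 * (c * Normc.normc z) <= 3 * Normc.normc (g z) <= 4 * (c * Normc.normc z)) ->
  count (fun l => 8 * Normc.normc l <= r) ps = 1%N.
Proof.
move=> r0 c0 psP qsP gP; have r40 : 0 < r / 4 by rewrite divr_gt0.
(* [m] is chosen so that the errors, at most [3 ^ N], stay below [2 ^ m]. *)
pose N := (size ps + size qs)%N; pose m := (2 * N).+1.
have m0 : (0 < m)%N by [].
have [s [sz sr sE]] := circle_points m0 (ltW r0).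
have [s' [sz' sr' sE']] := circle_points m0 (ltW r40).
have [P0 P1 P2] := prod_dist_ratio m0 r0 psP.
have qsP' l : l \in qs -> 8 * Normc.normc l <= r \/ 2 * r <= Normc.normc l.
  by move=> /qsP; right.
have qs0 : count (fun l => 8 * Normc.normc l <= r) qs = 0%N.
  apply/eqP; rewrite eqn0Ngt -has_count -all_predC; apply/allP => l /qsP lr /=.
  by rewrite -ltNge; lra.
have [Q0 Q1 Q2] := prod_dist_ratio m0 r0 qsP'.
move: Q1 Q2; rewrite qs0 muln0 expr0 mul1r.
move: P1 P2; set k := count _ ps.
have PE : \prod_(l <- ps) Normc.normc (l ^+ m - (r ^+ m)%:C) =
    \prod_(l <- qs) Normc.normc (l ^+ m - (r ^+ m)%:C) *
    \prod_(y <- s) Normc.normc (g y).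
  rewrite -!(prod_horner_circle _ sE) -big_split /=; apply: eq_big_seq => y /sr yr.
  by have [-> _] := gP y (or_introl yr); rewrite Normc.normcM.
have PE' : \prod_(l <- ps) Normc.normc (l ^+ m - ((r / 4) ^+ m)%:C) =
    \prod_(l <- qs) Normc.normc (l ^+ m - ((r / 4) ^+ m)%:C) *
    \prod_(y <- s') Normc.normc (g y).
  rewrite -!(prod_horner_circle _ sE') -big_split /=; apply: eq_big_seq => y /sr' yr.
  by have [-> _] := gP y (or_intror yr); rewrite Normc.normcM.
set P := \prod_(l <- ps) _ in PE *; set P' := \prod_(l <- ps) _ in PE' P0 *.
set Q := \prod_(l <- qs) _ in PE *; set Q' := \prod_(l <- qs) _ in PE' Q0 *.
have G_ge : (2 / 3 * (c * r)) ^+ m <= \prod_(y <- s) Normc.normc (g y).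
  rewrite -[X in _ ^+ X]sz; apply: prod_ge_exp => [|y /sr yr].
    by rewrite !mulr_ge0 ?invr_ge0 // ltW.
  by have [_ /andP[]] := gP y (or_introl yr); rewrite yr => h _; lra.
have G_le : \prod_(y <- s) Normc.normc (g y) <= (4 / 3 * (c * r)) ^+ m.
  rewrite -[X in _ ^+ X]sz; apply: prod_le_exp => y /sr yr; rewrite normc_ge0.
  by have [_ /andP[]] := gP y (or_introl yr); rewrite yr => _ h; lra.
have G'_ge : (c * r / 6) ^+ m <= \prod_(y <- s') Normc.normc (g y).
  rewrite -[X in _ ^+ X]sz'; apply: prod_ge_exp => [|y /sr' yr].
    by rewrite !mulr_ge0 ?invr_ge0 // ltW.
  by have [_ /andP[]] := gP y (or_intror yr); rewrite yr => h _; lra.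
have G'_le : \prod_(y <- s') Normc.normc (g y) <= (c * r / 3) ^+ m.
  rewrite -[X in _ ^+ X]sz'; apply: prod_le_exp => y /sr' yr; rewrite normc_ge0.
  by have [_ /andP[]] := gP y (or_intror yr); rewrite yr => _ h; lra.
move: PE PE' G_ge G_le G'_ge G'_le.
set G := \prod_(y <- s) _; set G' := \prod_(y <- s') _.
(* The bounds at radius [r] are expressed by the extreme values [c * r / 3] and [c * r / 6] at
   radius [r / 4], whence the ratios 2 and 8. *)
have -> : 2 / 3 * (c * r) = 2 * (c * r / 3) by field.
have -> : 4 / 3 * (c * r) = 8 * (c * r / 6) by field.
rewrite (exprMn m 2) (exprMn m 8) => PE PE' G_ge G_le G'_ge G'_le P1 P2 Q1 Q2.
have e2 : 0 < 2 ^+ m :> R by rewrite exprn_gt0.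
have e8 : 0 < 8 ^+ m :> R by rewrite exprn_gt0.
have GG' : 2 ^+ m * G' <= G by apply: le_trans G_ge; rewrite ler_pM2l.
have G'G : G <= 8 ^+ m * G' by apply: le_trans G_le _; rewrite ler_pM2l.
have p3 (j : nat) : 0 < 3 ^+ j :> R by rewrite exprn_gt0.
have N3 : 3 ^+ N < 2 ^+ m :> R.
  rewrite exprS exprM; apply: (@le_lt_trans _ _ ((2 ^+ 2) ^+ N)).
    by apply: lerXn2r; rewrite ?nnegrE // -natrX ler_nat.
  by rewrite ltr_pMl ?exprn_gt0 // ltr1n.
have G'0 : 0 < G' by rewrite -(pmulr_rgt0 _ Q0) -PE'.
have up : 4 ^+ (m * k) <= 3 ^+ N * 8 ^+ m :> R.
  rewrite -(ler_pM2r P0); apply: (le_trans P2).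
  have : Q * G <= 3 ^+ size qs * Q' * (8 ^+ m * G').
    apply: (@le_trans _ _ (3 ^+ size qs * Q' * G)).
      by rewrite ler_wpM2r // (le_trans _ GG') // mulr_ge0 // ltW.
    by rewrite ler_wpM2l // mulr_ge0 // ltW.
  rewrite -PE -(ler_pM2l (p3 (size ps))); congr (_ <= _).
  by rewrite PE' /N exprD; ring.
(* [k = 0] would give [2 ^+ m <= 3 ^+ N], and [k >= 2] would give [16 ^+ m <= 3 ^+ N * 8 ^+ m]; both
   contradict [N3]. *)
case kE : k up P1 => [|[//|j]] up P1.
  have : 2 ^+ m * P' <= 3 ^+ N * P'.
    rewrite muln0 expr0 mul1r in P1.
    rewrite {1}PE' /N exprD -mulrA mulrCA.
    have h : Q' * (2 ^+ m * G') <= 3 ^+ size qs * P.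
      by rewrite PE [X in _ <= X]mulrA ler_pM ?mulr_ge0 // ltW.
    by rewrite (le_trans h) // mulrCA ler_pM2l.
  by rewrite ler_pM2r // leNgt N3.
have : 16 ^+ m <= 4 ^+ (m * j.+2) :> R.
  rewrite mulnC exprM; apply: lerXn2r; rewrite ?nnegrE ?exprn_ge0 //.
  by rewrite exprS exprS mulrA -natrM ler_peMr // exprn_ege1 // ler1n.
move=> /le_trans/(_ up); rewrite (_ : 16 = 2 * 8) ?exprMn ?ler_pM2r ?leNgt ?N3 //.
by rewrite -natrM.
Qed.

End RootCount.

(** * Eigenvalue estimates for one fixed matrix *)

(* L and E stand for N^e, with e small, and N^eps. *)
Section Deterministic.
Context (R : realType) (N : nat) (U : 'M[R[i]]_N) (v : 'cV[R[i]]_N) (L : R).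
Hypotheses (N_gt1 : (1 < N)%N) (uU : U \is unitarymx) (v1 : sqnorm v = 1).
Hypotheses (L_ge1 : 1 <= L) (omL : Normc.normc (omega1 U v) <= L)
  (Lom : L^-1 <= Normc.normc (omega1 U v)).
Hypothesis W2L : forall z, Normc.normc z < 1 - (N%:R ^+ 2)^-1 ->
  Normc.normc (W2 U v z) <=
  L * (Normc.normc z ^+ 2 / (Num.sqrt N%:R * (1 - Normc.normc z))).
Implicit Types (z l : R[i]) (t : R).

Let s : R := Num.sqrt N%:R.
Let om := omega1 U v.

Let N_ge2 : 2 <= N%:R :> R. Proof. by rewrite ler_nat. Qed.
Let s_ge1 : 1 <= s.
Proof. by rewrite -sqrtr1 ler_sqrt; have := N_ge2; lra. Qed.
Let s_gt0 : 0 < s. Proof. exact: lt_le_trans s_ge1. Qed.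
Let L_gt0 : 0 < L. Proof. exact: lt_le_trans L_ge1. Qed.
Let om_gt0 : 0 < Normc.normc om.
Proof. by apply: lt_le_trans Lom; rewrite invr_gt0. Qed.
Let om_neq0 : om != 0. Proof. by rewrite -normc_eq0 gt_eqF. Qed.
Let sC_neq0 : s%:C != 0. Proof. by rewrite -normc_eq0 normc_real normr_eq0 gt_eqF. Qed.

Let normc_om_s : Normc.normc (om / s%:C) = Normc.normc om / s.
Proof. by rewrite (Normc.normcM om) Normc.normcV normc_real gtr0_norm. Qed.

Let poisson_formE z : Normc.normc z < 1 ->
  poisson_form U v z - 1 = z * (om / s%:C) + W2 U v z.
Proof.
move=> z1; rewrite (poisson_form_split uU v1 z1) -(addrA 1) [1 + _]addrC addrK.
by rewrite /om /omega1 -/s mulrAC divff ?mul1r.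
Qed.

(** Makes the open disk of [W2L] contain the closed disk of radius [1 - 1/N]. *)
Let invNN : (N%:R ^+ 2)^-1 < N%:R^-1 :> R.
Proof.
move: N_ge2; move: (N%:R : R) => x x2.
by rewrite ltf_pV2 ?posrE ?exprn_gt0 //; nra.
Qed.

(** Justifies the radius [1 - 1/N]: the additive 3 of [radial_growth], once multiplied by [1/N],
    stays of order [L / s]. *)
Let invN_le : N%:R^-1 <= L / s.
Proof.
apply: (@le_trans _ _ s^-1); last by rewrite ler_peMl // invr_ge0 ltW.
have sE : s ^+ 2 = N%:R by rewrite sqr_sqrtr // ler0n.
rewrite -sE lef_pV2 ?posrE ?exprn_gt0 //.
by rewrite expr2 ler_peMl // ltW.
Qed.

Let growth_inside z : Normc.normc z <= 1 - N%:R^-1 ->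
  (1 - Normc.normc z) * Normc.normc (poisson_form U v z - 1) <= 2 * (L / s).
Proof.
move=> zN; have iN0 : 0 < N%:R^-1 :> R by rewrite invr_gt0; have := N_ge2; lra.
have z1 : Normc.normc z < 1 by lra.
have zW : Normc.normc z < 1 - (N%:R ^+ 2)^-1 by have := invNN; lra.
rewrite (poisson_formE z1).
have z0 := normc_ge0 z; set b := 1 - Normc.normc z; have b0 : 0 < b by rewrite subr_gt0.
have b1 : b <= 1 by rewrite gerBl.
apply: le_trans (ler_wpM2l (ltW b0) (normc_triangle _ _)) _.
rewrite (Normc.normcM z) normc_om_s mulrDr.
have -> : 2 * (L / s) = L / s + L / s by ring.
apply: lerD.
  rewrite !mulrA ler_pM2r ?invr_gt0 // -[leRHS]mul1r.
  apply: ler_pM; [by rewrite mulr_ge0 // ltW | exact: normc_ge0 | | exact: omL].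
  by rewrite mulr_ile1 // ltW.
apply: le_trans (ler_wpM2l (ltW b0) (W2L zW)) _; rewrite -/s -/b.
have -> : b * (L * (Normc.normc z ^+ 2 / (s * b))) = Normc.normc z ^+ 2 * (L / s).
  by field; rewrite !gt_eqF.
by rewrite ger_pMl ?divr_gt0 // expr_le1 // ltW.
Qed.

(** Here [i] is [1/N] and [q] is [L / s]; the constant is [15 = 6 * 2 + 3]. *)
Let growth_arith (x q w i : R) : x <= (1 - (1 - i)) * (6 * w + 3) ->
  (1 - (1 - i)) * w <= 2 * q -> i <= q -> x <= 15 * q.
Proof. by move=> h1 h2 h3; lra. Qed.

Lemma poisson_form_growth z : Normc.normc z < 1 ->
  (1 - Normc.normc z) * Normc.normc (poisson_form U v z - 1) <= 15 * (L / s).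
Proof.
move=> z1; have Ls0 : 0 < L / s by rewrite divr_gt0.
have [/growth_inside|zN] := leP (Normc.normc z) (1 - N%:R^-1); first by lra.
have iN0 : 0 < N%:R^-1 :> R by rewrite invr_gt0; have := N_ge2; lra.
(* Ensures [|z| > 1/2], so that z can be rescaled by [k] to modulus [1 - 1/N]. *)
have iN1 : N%:R^-1 <= 2^-1 :> R by rewrite lef_pV2 ?posrE; have := N_ge2; lra.
set a := Normc.normc z in z1 zN *; pose k : R := (1 - N%:R^-1) / a.
have a0 : 0 < a by lra.
have k0 : 0 < k by rewrite divr_gt0 //; lra.
have ka : k * a = 1 - N%:R^-1 by rewrite /k divfK // gt_eqF.
have k1 : k < 1 by rewrite ltr_pdivrMr // mul1r.
pose z0 := k%:C * z.
have z0E : Normc.normc z0 = 1 - N%:R^-1.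
  by rewrite /z0 Normc.normcM normc_real gtr0_norm.
have zz0 : Normc.normc (z - z0) = a - (1 - N%:R^-1).
  have -> : z - z0 = (1 - k)%:C * z by rewrite rmorphB rmorph1 mulrBl mul1r.
  by rewrite Normc.normcM normc_real gtr0_norm ?subr_gt0 // mulrBl mul1r ka.
have h0 := growth_inside (z := z0); rewrite z0E lexx in h0.
have {}h0 := h0 isT.
have := radial_growth uU v1 (z := z) (z0 := z0) z1; rewrite z0E zz0 -/a.
have zd : a - (1 - N%:R^-1) <= 1 - (1 - N%:R^-1) by lra.
move=> /(_ (ltW zN) zd) h1; exact: growth_arith h1 h0 invN_le.
Qed.

(** In the open disk the factor [char_poly U] of [char_poly_G] cannot vanish, as [U] has its
    eigenvalues on the circle; what remains is [(1 - t) K(l) = 1]. *)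
Lemma eigenvalue_inside t l : -1 < t < 1 -> l \in eigenvalues (G U v t) ->
  Normc.normc l < 1 -> poisson_form U v l - 1 = (t / (1 - t))%:C.
Proof.
move=> /andP[_ t1] lG l1.
have : root (char_poly (G U v t)) l.
  by rewrite char_poly_eigenvalues root_prod_XsubC.
rewrite rootE (char_poly_G v t uU l1) mulf_eq0 => /orP[|].
  rewrite -[_ == 0]/(root _ l) char_poly_eigenvalues root_prod_XsubC.
  by move=> /(eigenvalues_unitary uU) lE; move: l1; rewrite lE ltxx.
have t10 : 1 - t != 0 by rewrite subr_eq0 gt_eqF.
have c0 : (1 - t)%:C != 0 by rewrite -normc_eq0 normc_real normr_eq0.
rewrite subr_eq0 => /eqP KE; apply: (mulfI c0); rewrite mulrBr -KE mulr1.
rewrite -(rmorphM (real_complex R)) mulrCA divff // mulr1.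
by rewrite (rmorphB (real_complex R)) rmorph1 subKr.
Qed.

Let normc_z_t t :
  Normc.normc (z_t U v t) = s / Normc.normc om * `|t / (1 - t)|.
Proof.
rewrite /z_t -/s -/om (Normc.normcM (_ / _)) (Normc.normcM s%:C) Normc.normcV.
by rewrite !normc_real gtr0_norm.
Qed.

(** An eigenvalue in that disk would satisfy [E < |z_t| (1 - |l|)]. But
    [|z_t| = s / |om| * |K(l) - 1|], so the growth bound makes the right side at most
    [15 L / |om| <= 15 L^2]. *)
Lemma no_outlier_inside t l (E : R) : 15 * L ^+ 2 < E -> -1 < t < 1 -> t != 0 ->
  l \in eigenvalues (G U v t) ->
  ~ open_disk 0 (1 - (Normc.normc (z_t U v t))^-1 * E) l.
Proof.
move=> LE t1 t0 lG; rewrite /open_disk /= subr0 => lE.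
have E0 : 0 < E by apply: le_lt_trans LE; rewrite mulr_ge0 ?sqr_ge0.
have ct : 1 - t != 0 by case/andP: t1 => _ t1; rewrite subr_eq0 gt_eqF.
have q0 : 0 < `|t / (1 - t)| by rewrite normr_gt0 mulf_neq0 ?invr_eq0.
have zt0 : 0 < Normc.normc (z_t U v t).
  by rewrite normc_z_t !mulr_gt0 ?invr_gt0.
have l1 : Normc.normc l < 1.
  by apply: lt_le_trans lE _; rewrite gerBl mulr_ge0 ?invr_ge0 // ltW.
have KE := eigenvalue_inside t1 lG l1.
have := poisson_form_growth l1; rewrite KE normc_real.
have h : E < Normc.normc (z_t U v t) * (1 - Normc.normc l).
  by rewrite -ltr_pdivrMl //; lra.
move: h; rewrite normc_z_t; move: (`|_|) => q in q0 *.
move: (1 - _) => b h1 h2.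
have h3 : E < 15 * (L / Normc.normc om).
  apply: lt_le_trans h1 _.
  have -> : s / Normc.normc om * q * b = s / Normc.normc om * (b * q) by ring.
  have -> : 15 * (L / Normc.normc om) = s / Normc.normc om * (15 * (L / s)).
    by field; rewrite !gt_eqF.
  by rewrite ler_pM2l // divr_gt0.
have : L / Normc.normc om <= L ^+ 2.
  by rewrite expr2 ler_pM2l // invf_ple ?posrE.
lra.
Qed.

(** * The outlier for small t *)

Section SmallPerturbation.
Variables (t E : R).
Hypotheses (t_lt1 : -1 < t < 1) (t_half : `|t| <= 2^-1) (E2 : 2 <= E) (LE : 12 * L ^+ 2 <= E)
  (tE : 96 * (s * L * `|t|) <= E^-1).

Let zt := z_t U v t.
(** The error term of the fixed-point form [z = zt - h z] of the eigenvalue equation. *)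
Let h z := (s%:C / om) * W2 U v z.

Let t1_gt0 : 0 < 1 - t. Proof. by case/andP: t_lt1 => _; rewrite subr_gt0. Qed.

(** The smaller counting circle has radius [E^-1 / 8], and 48 yields [6 |zt| <= |z|] there; the 96
    of [tE] allows for [1 / (1 - t) <= 2]. *)
Let zt_small : 48 * Normc.normc zt <= E^-1.
Proof.
apply: le_trans tE; rewrite /zt normc_z_t normrM normfV (gtr0_norm t1_gt0).
have it1 : (1 - t)^-1 <= 2.
  by rewrite invf_ple ?posrE //; have := ler_norm t; have := t_half; lra.
have iom : (Normc.normc om)^-1 <= L by rewrite invf_ple ?posrE.
have h1 : s / Normc.normc om * (`|t| / (1 - t)) <= s * L * (`|t| * 2).
  apply: ler_pM; rewrite ?mulr_ge0 ?invr_ge0 ?(ltW s_gt0) ?(ltW om_gt0) ?(ltW t1_gt0) //.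
    by rewrite ler_pM2l.
  by rewrite ler_wpM2l.
have -> : 96 * (s * L * `|t|) = 48 * (s * L * (`|t| * 2)) by ring.
by rewrite ler_pM2l.
Qed.

Let E_gt0 : 0 < E. Proof. exact: lt_le_trans E2. Qed.
Let iE_gt0 : 0 < E^-1. Proof. by rewrite invr_gt0. Qed.
Let iE_half : E^-1 <= 2^-1. Proof. by rewrite lef_pV2 ?posrE. Qed.
Let EiE : E * E^-1 = 1. Proof. by rewrite divff // gt_eqF. Qed.

Let h_le z : Normc.normc z <= E^-1 ->
  Normc.normc (h z) <= 2 * L ^+ 2 * Normc.normc z ^+ 2.
Proof.
move=> zE; have z0 := normc_ge0 z.
have zh : Normc.normc z <= 2^-1 by exact: le_trans iE_half.
have zW : Normc.normc z < 1 - (N%:R ^+ 2)^-1.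
  have i2 : N%:R^-1 <= 2^-1 :> R by rewrite lef_pV2 ?posrE; have := N_ge2; lra.
  have i := invNN; lra.
rewrite /h (Normc.normcM (_ / _)) (Normc.normcM s%:C) Normc.normcV normc_real.
rewrite (gtr0_norm s_gt0).
have q0 : 0 < s / Normc.normc om by rewrite divr_gt0.
apply: le_trans (ler_wpM2l (ltW q0) (W2L zW)) _; rewrite -/s.
set a := Normc.normc z in z0 zh *; set q := Normc.normc om in q0 *.
have qp : 0 < q := om_gt0; have Lq : L^-1 <= q := Lom.
have a1 : 0 < 1 - a by lra.
have -> : s / q * (L * (a ^+ 2 / (s * (1 - a)))) = (1 - a)^-1 * (L * q^-1) * a ^+ 2.
  by field; rewrite !gt_eqF.
rewrite ler_wpM2r ?sqr_ge0 //; apply: ler_pM; rewrite ?mulr_ge0 ?invr_ge0 ?(ltW a1) ?(ltW L_gt0) ?(ltW qp) //.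
  by rewrite invf_ple ?posrE //; lra.
rewrite expr2 ler_wpM2l ?(ltW L_gt0) // invf_ple ?posrE //.
Qed.

(** With the same factor 6 for [zt], this keeps [z - zt + h z] within [|z| / 3] of z, the window
    that [count_small_roots] asks for. *)
Let h_le_small z : Normc.normc z <= E^-1 -> 6 * Normc.normc (h z) <= Normc.normc z.
Proof.
move=> zE; apply: le_trans (ler_wpM2l _ (h_le zE)) _ => //.
have -> : 6 * (2 * L ^+ 2 * Normc.normc z ^+ 2) =
  (12 * L ^+ 2) * Normc.normc z * Normc.normc z by ring.
rewrite -[leRHS]mul1r ler_wpM2r ?normc_ge0 // -[leRHS]EiE.
apply: ler_pM; [by rewrite mulr_ge0 ?sqr_ge0 | exact: normc_ge0 | exact: LE | exact: zE].
Qed.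

Let poisson_form_t z : Normc.normc z < 1 ->
  1 - (1 - t)%:C * poisson_form U v z =
  - ((1 - t)%:C * (om / s%:C)) * (z - zt + h z).
Proof.
move=> z1; have -> : poisson_form U v z = 1 + (z * (om / s%:C) + W2 U v z).
  by rewrite -(poisson_formE z1) addrC subrK.
rewrite /zt /h /z_t -/s -/om (fmorph_div (real_complex R)) /=.
have c0 : (1 - t)%:C != 0 by rewrite -normc_eq0 normc_real normr_eq0 gt_eqF.
have tc : (1 - t)%:C = 1 - t%:C by rewrite (rmorphB (real_complex R)) rmorph1.
rewrite tc in c0 *; move: (W2 U v z) om_neq0 sC_neq0 c0.
move: (t%:C) (s%:C) om => T S o W o0 S0 c0; field.
by rewrite o0 S0 c0.
Qed.

Let outlier l := centered_disk zt (Normc.normc zt ^+ 2 * E) l.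

(** The equation gives [|l - zt| = |h l| <= 2 L^2 |l|^2]. As [|h l|] is at most [|l| / 6], also
    [|l| <= 2 |zt|], and [8 L^2 |zt|^2] is below the radius when [zt] is nonzero. *)
Let eigenvalue_outlier l : l \in eigenvalues (G U v t) -> Normc.normc l < E^-1 ->
  outlier l.
Proof.
move=> lG lE; have l1 : Normc.normc l < 1 by have := iE_half; lra.
have : 1 - (1 - t)%:C * poisson_form U v l = 0.
  have -> : poisson_form U v l = 1 + (t / (1 - t))%:C.
    by rewrite -(eigenvalue_inside t_lt1 lG l1) addrC subrK.
  rewrite mulrDr mulr1 -(rmorphM (real_complex R)) mulrCA divff ?gt_eqF // mulr1.
  by rewrite (rmorphB (real_complex R)) rmorph1 subrK subrr.
rewrite poisson_form_t // => /eqP; rewrite mulf_eq0 oppr_eq0.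
have -> : ((1 - t)%:C * (om / s%:C) == 0) = false.
  apply/negbTE/mulf_neq0; first by rewrite -normc_eq0 normc_real normr_eq0 gt_eqF.
  by apply: mulf_neq0 om_neq0 _; rewrite invr_eq0.
rewrite orFb addr_eq0 => /eqP lzt.
have h1 := h_le (ltW lE); have h2 := h_le_small (ltW lE).
have lzt2 : Normc.normc (l - zt) = Normc.normc (h l) by rewrite lzt normc_opp.
have l2 : Normc.normc l <= 2 * Normc.normc zt.
  have := normc_dist_ge l zt; rewrite lzt2.
  by have := normc_ge0 l; lra.
(* For [zt = 0] the open disk is empty, and [l = 0] is the center that [centered_disk] adds. *)
have [zt0|zt0] := eqVneq zt 0.
  left; apply/eqP; rewrite zt0 -normc_eq0 eq_le normc_ge0 andbT.
  by rewrite (le_trans l2) // zt0 Normc.normc0 mulr0.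
right; rewrite /open_disk /= lzt2.
have zt0' : 0 < Normc.normc zt by rewrite lt_def normc_ge0 normc_eq0 zt0.
apply: le_lt_trans h1 _.
have h3 : Normc.normc l ^+ 2 <= 4 * Normc.normc zt ^+ 2.
  have -> : 4 * Normc.normc zt ^+ 2 = (2 * Normc.normc zt) ^+ 2 by ring.
  by apply: lerXn2r; rewrite ?nnegrE ?mulr_ge0 ?normc_ge0.
have L20 : 0 < L ^+ 2 by rewrite exprn_gt0.
apply: le_lt_trans (ler_wpM2l _ h3) _; first by rewrite mulr_ge0 // ltW.
have -> : 2 * L ^+ 2 * (4 * Normc.normc zt ^+ 2) = 8 * L ^+ 2 * Normc.normc zt ^+ 2.
  by ring.
by rewrite [ltRHS]mulrC ltr_pM2r ?exprn_gt0 //; have := LE; lra.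
Qed.

Let outlier_small l : outlier l -> Normc.normc l <= 2 * Normc.normc zt.
Proof.
have z0 := normc_ge0 zt.
case=> [->|]; first by lra.
rewrite /open_disk /= => lz; have := normc_dist_ge l zt.
have : Normc.normc zt ^+ 2 * E <= Normc.normc zt.
  rewrite expr2 -mulrA ler_piMr // -[leRHS]EiE mulrC ler_wpM2l ?(ltW E_gt0) //.
  by have := zt_small; lra.
by move=> h1 h2; lra.
Qed.

Lemma one_outlier_inside :
  let outlier := centered_disk (z_t U v t) (Normc.normc (z_t U v t) ^+ 2 * E) in
  count (fun l => `[< outlier l >]) (eigenvalues (G U v t)) = 1%N /\
  forall l, l \in eigenvalues (G U v t) -> ~ outlier l -> ~ open_disk 0 E^-1 l.
Proof.
move=> D; rewrite /D -/zt -[centered_disk _ _]/outlier {D}.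
have in_outlier l : l \in eigenvalues (G U v t) -> ~ outlier l -> ~ open_disk 0 E^-1 l.
  by move=> lG lout; rewrite /open_disk /= subr0 => /(eigenvalue_outlier lG).
(* Eigenvalues of modulus below [E^-1 = 2 r] lie in the outlier disk, hence satisfy [8 |l| <= r]:
   this is the gap needed for counting. *)
split=> //; pose r := E^-1 / 2.
have r0 : 0 < r by rewrite divr_gt0.
have small l : l \in eigenvalues (G U v t) ->
    `[< outlier l >] = (8 * Normc.normc l <= r).
  move=> lG; apply/asboolP/idP => [/outlier_small lzt|lr].
    by have := zt_small; have := iE_gt0; rewrite /r; lra.
  apply: eigenvalue_outlier => //; move: lr; rewrite /r.
  by have := iE_gt0; lra.
rewrite (eq_in_count small).
(* The modulus of the coefficient of z in [1 - (1 - t) K(z)]. *)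
pose c := (1 - t) * (Normc.normc om / s).
have c0 : 0 < c by rewrite mulr_gt0 ?divr_gt0.
apply: (@count_small_roots _ (eigenvalues (G U v t)) (eigenvalues U) r c
  (fun z => 1 - (1 - t)%:C * poisson_form U v z) r0 c0).
- move=> l lG; have [lE|lE] := ltP (Normc.normc l) E^-1; last by right; rewrite /r; lra.
  by left; rewrite -small //; apply/asboolP; exact: eigenvalue_outlier.
- by move=> l /(eigenvalues_unitary uU) ->; rewrite /r; have := iE_half; lra.
move=> z zr; have zE : Normc.normc z <= E^-1.
  by have := iE_gt0; case: zr => ->; rewrite /r; lra.
have z1 : Normc.normc z < 1 by have := iE_half; lra.
rewrite -!char_poly_eigenvalues (char_poly_G v t uU z1); split; first exact: erefl.
rewrite (poisson_form_t z1) (Normc.normcM (- _)) normc_opp (Normc.normcM (1 - t)%:C).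
rewrite normc_om_s normc_real (gtr0_norm t1_gt0) -/c.
have ztz : 6 * Normc.normc zt <= Normc.normc z.
  by have := zt_small; have := iE_gt0; case: zr => ->; rewrite /r; lra.
have hz := h_le_small zE.
have up : 3 * Normc.normc (z - zt + h z) <= 4 * Normc.normc z.
  have := normc_triangle (z - zt) (h z); have := normc_triangle z (- zt).
  by rewrite normc_opp; lra.
have lo : 2 * Normc.normc z <= 3 * Normc.normc (z - zt + h z).
  have := normc_dist_ge (z - zt) (- h z); have := normc_dist_ge z zt.
  by rewrite normc_opp opprK; lra.
by rewrite !(mulrCA _ c) !ler_pM2l // lo.
Qed.

End SmallPerturbation.
End Deterministic.

(** * Events of high probability *)

Lemma probability_setI_ge d (T : measurableType d) (R : realType)
    (P : probability T R) (A B : set T) : measurable A -> measurable B ->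
  (P A + P B - 1 <= P (A `&` B))%E.
Proof.
move=> mA mB; have mAB : measurable (A `&` B) by exact: measurableI.
have : (P A <= P (A `&` B) + (1 - P B))%E.
  have hU : (P (A `&` B `|` ~` B) <= P (A `&` B) + P (~` B))%E.
    by apply: measureU2 => //; exact: measurableC.
  rewrite -probability_setC //; apply: le_trans hU.
  apply: le_measure; rewrite ?inE //.
    by apply: measurableU => //; exact: measurableC.
  by move=> x Ax; have [Bx|nBx] := pselect (B x); [left|right].
have /fineK <- := fin_num_measure P _ mA.
have /fineK <- := fin_num_measure P _ mB.
have /fineK <- := fin_num_measure P _ mAB.
move: (fine _) (fine _) (fine _) => c b a.
by rewrite -!(EFinD, EFinB) !lee_fin => h; lra.
Qed.

Section HighProbability.
Context (R : realType) (d : nat -> measure_display)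
        (T : forall N, measurableType (d N)) (P : forall N, probability (T N) R).
Implicit Types E : forall N, set (T N).

Lemma with_high_probability_sub (N0 : nat) E1 E2 :
  (forall N, (N0 <= N)%N -> E1 N `<=` E2 N) ->
  with_high_probability P E1 -> with_high_probability P E2.
Proof.
move=> E12 [F [mF FE cF]].
(* Below [N0] no inclusion is known; the empty set is safe there and does not affect the limit. *)
exists (fun N => if (N0 <= N)%N then F N else set0); split.
- by move=> N; case: ifP => // _; exact: measurable0.
- by move=> N; case: ifPn => [/E12 + x /FE|_ x //]; apply.
- apply: cvg_trans cF; apply: near_eq_cvg; near=> N.
  by rewrite ifT //; near: N; exact: nbhs_infty_ge.
Unshelve. all: by end_near. Qed.

Lemma with_high_probability_setI E1 E2 :
  with_high_probability P E1 -> with_high_probability P E2 ->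
  with_high_probability P (fun N => E1 N `&` E2 N).
Proof.
move=> [F1 [mF1 FE1 c1]] [F2 [mF2 FE2 c2]].
have mF N : measurable (F1 N `&` F2 N) by exact: measurableI.
exists (fun N => F1 N `&` F2 N); split=> //.
  by move=> N; apply: setISS.
apply: (@squeeze_cvge _ _ _ _ (fun N => P N (F1 N) + P N (F2 N) - 1)%E _
  (fun=> 1%E)); last exact: cvg_cst.
- near=> N; rewrite probability_le1 // andbT.
  exact: probability_setI_ge.
- rewrite [X in _ --> X](_ : 1 = 1 + 1 - 1)%E; last by rewrite addeK.
  by apply: cvgeB => //; [apply: cvgeD | exact: cvg_cst].
Unshelve. all: by end_near. Qed.

(** The exponent [A = 1] suffices: the probability is eventually at least [1 - 1/N]. *)
Lemma with_overwhelming_high_probability E :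
  with_overwhelming_probability P E -> with_high_probability P E.
Proof.
move=> [F [mF FE cF]]; exists F; split=> //.
apply: (@squeeze_cvge _ _ _ _ (fun N => (1 - N%:R^-1)%:E) _ (fun=> 1%E)).
- near=> N; rewrite probability_le1 // andbT.
  have : (1 - P N (F N) < (N%:R `^ (- 1))%:E)%E.
    by near: N; exact: cF.
  rewrite powR_inv1 // -(fineK (fin_num_measure (P N) _ (mF N))).
  by rewrite -EFinB lte_fin lee_fin; lra.
- apply: cvg_EFin; first by near=> N.
  rewrite -[X in _ --> X]subr0; apply: cvgB; first exact: cvg_cst.
  by rewrite -cvg_shiftS; exact: cvg_harmonic.
- exact: cvg_cst.
Unshelve. all: by end_near. Qed.

End HighProbability.

(** * From bounds in powers of N to the location of the eigenvalues *)

Section Location.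
Context (R : realType) (N : nat) (U : 'M[R[i]]_N) (v : 'cV[R[i]]_N).
Context (alpha eps e : R).
Hypotheses (N_gt1 : (1 < N)%N) (uU : U \is unitarymx) (v1 : sqnorm v = 1).
Hypotheses (e_eps : 4 * e <= eps) (e_alpha : 4 * e <= alpha - eps)
  (N_e : 5 <= N%:R `^ e).
Hypothesis om_bounds :
  N%:R `^ (- e) < Normc.normc (omega1 U v) < N%:R `^ e.
Hypothesis W2_bound : forall z, open_disk 0 (1 - N%:R `^ (- 2)) z ->
  Normc.normc (W2 U v z) <= N%:R `^ e * Normc.normc (Normc.normc z ^+ 2 /
    (Num.sqrt N%:R * (1 - Normc.normc z)))%:C.

Let N0 : 0 < N%:R :> R. Proof. by rewrite ltr0n (ltn_trans _ N_gt1). Qed.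
Let N1 : 1 <= N%:R :> R. Proof. by rewrite ler1n (ltn_trans _ N_gt1). Qed.
Let L := N%:R `^ e.
Let powD (a b : R) : N%:R `^ (a + b) = N%:R `^ a * N%:R `^ b.
Proof. by rewrite powRD //; apply/implyP => _; rewrite gt_eqF. Qed.
(** For [L >= 5] the fourth power exceeds [15 L^2], [12 L^2] and [96 L], hence the factor 4 in the
    conditions on [e]. *)
Let L4_le (a : R) : 4 * e <= a -> L ^+ 4 <= N%:R `^ a.
Proof.
move=> ea; rewrite -powR_mulrn ?powR_ge0 // /L -powRrM.
by apply: ler_powR => //; rewrite mulrC.
Qed.

(** [D] stays abstract so that one proof serves the open and the closed disk. *)
Lemma eigenvalue_location_holds (D : set R[i]) :
  (forall t l, -1 < t < 1 -> l \in eigenvalues (G U v t) -> D l) ->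
  eigenvalue_location D alpha eps U v.
Proof.
move=> GD t t1; have /andP[om1 om2] := om_bounds.
rewrite powRN in om1.
have s0 : 0 < Num.sqrt N%:R :> R by rewrite sqrtr_gt0.
have L1 : 1 <= L by apply: le_trans N_e; rewrite ler1n.
have W2L z : Normc.normc z < 1 - (N%:R ^+ 2)^-1 ->
    Normc.normc (W2 U v z) <=
    L * (Normc.normc z ^+ 2 / (Num.sqrt N%:R * (1 - Normc.normc z))).
  move=> zN; have z1 : 0 < 1 - Normc.normc z.
    rewrite subr_gt0 (lt_le_trans zN) // gerBl invr_ge0 exprn_ge0 //.
  (* The dominating function is a nonnegative real in the disk, so it equals its modulus. *)
  rewrite -[X in L * X]ger0_norm.
    rewrite -normc_real; apply: W2_bound.
    by rewrite /open_disk /= subr0 powRN powR_mulrn.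
  by rewrite divr_ge0 ?sqr_ge0 // mulr_ge0 // ltW.
pose E := N%:R `^ eps; have E0 : 0 < E by rewrite powR_gt0.
have LE4 : L ^+ 4 <= E by exact: L4_le.
have L5 : 5 <= L by exact: N_e.
have L2 : 25 <= L ^+ 2 by rewrite expr2; nra.
have LE : 15 * L ^+ 2 < E.
  by apply: lt_le_trans LE4; rewrite -[4%N]/(2 * 2)%N exprM expr2; nra.
split=> [t_small|t_large]; last first.
  have t0 : t != 0.
    by rewrite -normr_gt0 (le_lt_trans _ t_large) // powR_ge0.
  move=> l lG; split; first exact: GD lG.
  exact: (no_outlier_inside N_gt1 uU v1 L1 (ltW om2) (ltW om1) W2L LE t1 t0 lG).
have tE : 96 * (Num.sqrt N%:R * L * `|t|) <= E^-1.
  (* [Num.sqrt N * |t|] is at most [N^-alpha]; the surplus [N^(alpha - eps)] absorbs [96 L]. *)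
  have aE : E^-1 = N%:R `^ (- alpha) * N%:R `^ (alpha - eps).
    by rewrite -powRN -powD addrA addNr add0r.
  have tN : Num.sqrt N%:R * `|t| <= N%:R `^ (- alpha).
    move: (ltW t_small); rewrite powD (powRN _ 2^-1) powR12_sqrt ?(ltW N0) // => h.
    by rewrite mulrC -ler_pdivlMr // mulrC.
  have La := L4_le e_alpha.
  have LL : 96 * L <= L ^+ 4.
    by rewrite -[4%N]/(2 * 2)%N exprM [X in _ <= X]expr2; nra.
  rewrite aE; have -> : 96 * (Num.sqrt N%:R * L * `|t|) =
      Num.sqrt N%:R * `|t| * (96 * L) by ring.
  apply: ler_pM => //; rewrite ?mulr_ge0 ?(ltW s0) //; [lra | exact: le_trans La].
have E2 : 2 <= E by lra.
have LE12 : 12 * L ^+ 2 <= E by lra.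
have t_half : `|t| <= 2^-1.
  have iE : E^-1 <= 1 by rewrite invf_le1 //; lra.
  have s1 : 1 <= Num.sqrt N%:R :> R by rewrite -[leLHS]sqrtr1 ler_sqrt.
  have := normr_ge0 t; have : 1 <= Num.sqrt N%:R * L by rewrite mulr_ege1.
  by move: tE iE; move: (Num.sqrt _ * L) `|t| (E^-1) => a b c; nra.
have [cnt out] := one_outlier_inside N_gt1 uU v1 L1 (ltW om1) W2L
  t1 t_half E2 LE12 tE.
split=> // l lG lout; split; first exact: GD lG.
by rewrite powRN; apply: out.
Qed.

End Location.

(** * Choice of the exponents and conclusion *)

Theorem theorem9 (R : realType) (d : nat -> measure_display)
    (T : forall N, measurableType (d N)) (P : forall N, probability (T N) R)
    (U : forall N, T N -> 'M[R[i]]_N) (v : forall N, 'cV[R[i]]_N)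
    (U_random : forall N, random_matrix (U N))
    (U_unitary : forall N w, U N w \is unitarymx)
    (v_unit : forall N, (0 < N)%N -> (v N)^t* *m v N = 1%:M)
    (W2_regular : forall delta : R, 0 < delta ->
      stochastically_dominated P
        (fun N z w => W2 (U N w) (v N) z)
        (fun N z _ => (Normc.normc z ^+ 2 /
                        (Num.sqrt N%:R * (1 - Normc.normc z)))%:C)
        (fun N => open_disk 0 (1 - N%:R `^ (- delta))))
    (omega1_regular : forall eps : R, 0 < eps ->
      with_high_probability P (fun N => [set w |
        N%:R `^ (- eps) < Normc.normc (omega1 (U N w) (v N)) < N%:R `^ eps]))
    (alpha eps : R) (eps_gt0 : 0 < eps) (eps_lt_alpha : eps < alpha) :
  with_high_probability P (fun N => [set w |
    eigenvalue_location (closed_unit_disk R) alpha eps (U N w) (v N)]) /\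
  (with_high_probability P (fun N => [set w |
     no_orthogonal_eigenvector (U N w) (v N)]) ->
   with_high_probability P (fun N => [set w |
     eigenvalue_location (unit_disk R) alpha eps (U N w) (v N)])).
Proof.
(* A quarter of each margin, so that [N^(4 e)] fits into both [N^eps] and [N^(alpha - eps)]. *)
pose e := Num.min (eps / 4) ((alpha - eps) / 4).
have e_gt0 : 0 < e by rewrite lt_min !divr_gt0 ?subr_gt0.
have e_eps : 4 * e <= eps.
  have : e <= eps / 4 by rewrite ge_min lexx.
  lra.
have e_alpha : 4 * e <= alpha - eps.
  have : e <= (alpha - eps) / 4 by rewrite ge_min lexx orbT.
  lra.
(* From [N0] on, [N >= 2] and [N^e >= 5]. *)
pose N0 := maxn 2 (Num.bound (5 `^ e^-1 : R)).
have N0_e N : (N0 <= N)%N -> 5 <= N%:R `^ e :> R.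
  rewrite geq_max => /andP[_ N0N].
  have h : 5 `^ e^-1 <= N%:R :> R.
    apply: (@le_trans _ _ (Num.bound (5 `^ e^-1 : R))%:R); last by rewrite ler_nat.
    by rewrite ltW // archi_boundP // powR_ge0.
  have -> : 5 = (5 `^ e^-1) `^ e :> R.
    by rewrite -powRrM mulVf ?gt_eqF // powRr1.
  by apply: ge0_ler_powR; rewrite ?nnegrE ?powR_ge0 ?(ltW e_gt0).
have v1 N : (0 < N)%N -> sqnorm (v N) = 1.
  move=> N_gt0; apply: complexI; rewrite -inner_self v_unit //.
  by rewrite mxE eqxx.
(* Taking [delta = 2] reaches beyond the radius [1 - 1/N] where the radial comparison starts. *)
have regular := with_high_probability_setI
  (with_overwhelming_high_probability (W2_regular 2 (ltr0n R 2) e e_gt0))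
  (omega1_regular e e_gt0).
have locate N w (D : set R[i]) : (N0 <= N)%N ->
    (forall z, open_disk 0 (1 - N%:R `^ (- 2)) z ->
      Normc.normc (W2 (U N w) (v N) z) <= N%:R `^ e * Normc.normc
        (Normc.normc z ^+ 2 / (Num.sqrt N%:R * (1 - Normc.normc z)))%:C) ->
    N%:R `^ (- e) < Normc.normc (omega1 (U N w) (v N)) < N%:R `^ e ->
    (forall t l, -1 < t < 1 -> l \in eigenvalues (G (U N w) (v N) t) -> D l) ->
    eigenvalue_location D alpha eps (U N w) (v N).
  move=> N0N W2b omb GD; have N_gt1 : (1 < N)%N by move: N0N; rewrite geq_max => /andP[].
  exact: (eigenvalue_location_holds N_gt1 (U_unitary N w) (v1 N (ltnW N_gt1))
    e_eps e_alpha (N0_e N N0N) omb W2b GD).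
have N0_gt0 N : (N0 <= N)%N -> (0 < N)%N.
  by rewrite geq_max => /andP[/ltnW].
split=> [|noorth].
  apply: (with_high_probability_sub (N0 := N0)) regular => N N0N w [/= W2b omb].
  apply: locate => // t l t1 lG.
  by have [] := eigenvalues_G (U_unitary N w) (v1 N (N0_gt0 N N0N)) t1 lG.
apply: (with_high_probability_sub (N0 := N0)) (with_high_probability_setI regular noorth).
move=> N N0N w [[/= W2b omb] no_orth].
apply: locate => // t l t1 lG.
have [_ lt1] := eigenvalues_G (U_unitary N w) (v1 N (N0_gt0 N N0N)) t1 lG.
by rewrite /unit_disk /open_disk /= subr0; exact: lt1.
Qed.
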